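(* Let $k\geq 2$ and $l\geq 2$ be integers. Every $81k^2(l+2)^2$-strong $l$-quasi-transitive digraph is $k$-linked.
   Context: All digraphs are finite and simple (no loops, no parallel arcs; opposite arcs allowed). Paths are directed with distinct vertices; the length of a path is its number of arcs; ''disjoint'' means vertex-disjoint. A digraph $D$ is $l$-quasi-transitive if for every pair of vertices $u,v$, the existence of a directed $(u,v)$-path of length $l$ in $D$ implies that there is at least one arc between $u$ and $v$. A digraph is $m$-strong if it has at least $m+1$ vertices and deleting any at most $m-1$ vertices leaves it strongly connected. $D$ is $k$-linked if $|V(D)|\ge 2k$ and for any $2k$ distinct vertices $x_1,\dots,x_k,y_1,\dots,y_k$ there are disjoint paths $P_i$ from $x_i$ to $y_i$, $i\in[k]$. *)

(* Defs.v *)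
From mathcomp Require Import all_boot.
Set Implicit Arguments.
Unset Strict Implicit.
Unset Printing Implicit Defensive.

(* A finite simple digraph is an irreflexive relation [D : rel V] on a
   [finType] [V]; opposite arcs are allowed since [D] need not be
   antisymmetric. *)

(* The vertex sequence of the path is [u :: p], so its length is [size p]. *)
Definition dipath (V : finType) (D : rel V) (u v : V) (p : seq V) : Prop :=
  [/\ path D u p, last u p = v & uniq (u :: p)].

Definition quasi_transitive (V : finType) (D : rel V) (l : nat) : Prop :=
  forall u v : V, (exists p : seq V, dipath D u v p /\ size p = l) ->
    D u v \/ D v u.

Definition strongly_connected_on (V : finType) (D : rel V) (A : {set V}) :
    Prop :=
  forall u v : V, u \in A -> v \in A ->
    exists p : seq V, dipath D u v p /\ {subset u :: p <= A}.

(* [#|S| < m] rather than [#|S| <= m - 1], because subtraction is truncated. *)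
Definition strong (V : finType) (D : rel V) (m : nat) : Prop :=
  m + 1 <= #|V| /\
  forall S : {set V}, #|S| < m -> strongly_connected_on D (~: S).

Definition linked (V : finType) (D : rel V) (k : nat) : Prop :=
  2 * k <= #|V| /\
  forall x y : 'I_k -> V,
    injective x -> injective y -> (forall i j, x i <> y j) ->
    exists P : 'I_k -> seq V,
      (forall i, dipath D (x i) (y i) (P i)) /\
      (forall i j, i != j -> [disjoint x i :: P i & x j :: P j]).

(* Main.v *)
Require Import Defs.
From mathcomp Require Import all_boot zify.
From Stdlib Require Import Classical.
Set Implicit Arguments.
Unset Strict Implicit.
Unset Printing Implicit Defensive.

(** Put N = l^2 + 13 l + 2. If any two vertices outside any set of at most
k (N + 2) vertices are joined by a path of length at most N avoiding that set,
the pairs are linked greedily one after the other. Otherwise some v is at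
distance more than N from some u in D - S, with S small; let L_j be the set of
vertices of D - S at distance j from u. A path of length l from a vertex of L_j
to a vertex of L_i with i + 2 <= j forces the backward arc between its ends, and
iterating this yields complete backward adjacencies between many pairs of layers:
if j = l (mod 2) and j >= l, every vertex of L_j dominates L_(t(l-1)) whenever
t(l-1) + 2 <= j, and variants for the other parity and the other residues show
that each x_i reaches, by at most two arcs through fresh vertices, some x'_i in a
layer <= 2l, and that each y_i is reached in the same way from some y'_i in a
layer >= 13l. Menger's theorem gives 3k disjoint paths from a set containing the
x'_i to a set containing the y'_i. At least k of them neither start at an x'_i nor
end at a y'_j, so each pair gets one of these, R_i, for itself. From x'_i follow
its path up to layer 5l, jump back to layer 4(l-1) of R_i, follow R_i up to
layer 13l, jump back to the last vertex in layer 12(l-1) of the path ending at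
y'_i, and follow the latter. A path used at its beginning for x'_i and at its end
for y'_j causes no conflict, because the two pieces lie in disjoint sets of
layers. *)

(** * Subsets of prescribed size *)

Lemma subset_of_card (V : finType) (A : {set V}) (n : nat) :
  n <= #|A| -> exists2 B : {set V}, B \subset A & #|B| = n.
Proof.
move=> le_nA; exists [set x in take n (enum A)].
  by apply/subsetP=> x; rewrite inE => /mem_take; rewrite mem_enum.
rewrite cardsE (card_uniqP _) ?take_uniq ?enum_uniq // size_takel //.
by rewrite -cardE.
Qed.

Lemma subset_between_card (V : finType) (A C : {set V}) (n : nat) :
  A \subset C -> #|A| <= n <= #|C| ->
  exists B : {set V}, [/\ A \subset B, B \subset C & #|B| = n].
Proof.
move=> sAC /andP[le_An le_nC].
have := cardsDS sAC; have := subset_leq_card sAC => le_AC eD.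
have [E sE cE] := @subset_of_card _ (C :\: A) (n - #|A|) ltac:(lia).
exists (A :|: E); split; first exact: subsetUl.
  by rewrite subUset sAC (subset_trans sE (subsetDl _ _)).
rewrite cardsU cE; suff -> : A :&: E = set0 by rewrite cards0; lia.
apply/setP=> x; rewrite !inE; apply/negP=> /andP[xA /(subsetP sE)].
by rewrite inE xA.
Qed.

(** * Splitting paths and deleting an arc *)

Section PathSplitting.
Variables (V : finType) (D : rel V).

Lemma split_at (a v : V) p :
  v \in a :: p -> exists p1 p2, p = p1 ++ p2 /\ last a p1 = v.
Proof. by case/splitPl=> p1 p2 l1; exists p1, p2. Qed.

Lemma split_first (T : pred V) a p :
  has T (a :: p) ->
  exists p1 p2, [/\ p = p1 ++ p2, T (last a p1) & ~~ has T (belast a p1)].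
Proof.
elim: p a => [|b p IHp] a; first by rewrite /= orbF => Ta; exists [::], [::].
case Ta: (T a); first by exists [::], (b :: p).
rewrite [has _ _]/= Ta => /IHp[p1 [p2 [-> Tl nT]]].
by exists (b :: p1), p2; split=> //=; rewrite Ta.
Qed.

Lemma split_last (T : pred V) a p :
  has T (a :: p) ->
  exists p1 p2, [/\ p = p1 ++ p2, T (last a p1) & ~~ has T p2].
Proof.
elim: p a => [|b p IHp] a; first by rewrite /= orbF => Ta; exists [::], [::].
case hp: (has T (b :: p)).
  by move=> _; have [p1 [p2 [-> Tl nT]]] := IHp _ hp; exists (b :: p1), p2.
by rewrite [has _ (a :: _)]/= -/(has T (b :: p)) hp orbF => Ta;
   exists [::], (b :: p); rewrite hp.
Qed.

Definition del_arc (x y : V) := [rel u v | D u v && ((u, v) != (x, y))].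

Lemma path_del_arc_src x y a p :
  path D a p -> x \notin belast a p -> path (del_arc x y) a p.
Proof.
elim: p a => //= b p IHp a /andP[Dab Dp].
rewrite inE negb_or => /andP[nxa nxp]; rewrite Dab IHp // andbT /=.
by apply: contra nxa => /eqP[-> _].
Qed.

Lemma path_del_arc_tgt x y a p :
  path D a p -> y \notin p -> path (del_arc x y) a p.
Proof.
elim: p a => //= b p IHp a /andP[Dab Dp].
rewrite inE negb_or => /andP[nxa nxp]; rewrite Dab IHp // andbT /=.
by apply: contra nxa => /eqP[_ ->].
Qed.

End PathSplitting.

(** * Menger's theorem for two vertex sets *)

Definition unseparated (V : finType) (D : rel V) (A B : {set V}) n :=
  forall X : {set V}, #|X| < n ->
  exists a p, [/\ a \in A, path D a p, last a p \in B
                & forall v, v \in a :: p -> v \notin X].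

(** The family is indexed by its starting vertices; [Q a] omits [a] itself, and [Q] is unconstrained
    off [A]. *)
Definition disjoint_paths (V : finType) (D : rel V) (A B : {set V})
    (Q : V -> seq V) :=
  (forall a, a \in A ->
     [/\ path D a (Q a), last a (Q a) \in B & uniq (a :: Q a)]) /\
  (forall a b v, a \in A -> b \in A -> v \in a :: Q a -> v \in b :: Q b ->
     a = b).

Lemma disjoint_paths_last_inj (V : finType) (D : rel V) (A B : {set V})
    (Q : V -> seq V) :
  disjoint_paths D A B Q -> {in A &, injective (fun a => last a (Q a))}.
Proof.
move=> [_ dQ] a b aA bA eq_l; apply: (dQ a b (last a (Q a))) => //.
  exact: mem_last.
by rewrite eq_l mem_last.
Qed.

Lemma disjoint_paths_last_img (V : finType) (D : rel V) (A B : {set V})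
    (Q : V -> seq V) :
  disjoint_paths D A B Q -> #|B| <= #|A| ->
  [set last a (Q a) | a in A] = B.
Proof.
move=> dQ le_BA; apply/eqP; rewrite eqEcard; apply/andP; split.
  by apply/subsetP=> _ /imsetP[a aA ->]; case: (dQ.1 _ aA).
by rewrite card_in_imset //; apply: disjoint_paths_last_inj dQ.
Qed.

(* Goering's induction: if deleting an arc xy creates a separator X with fewer
   than n vertices, then X + x and X + y are tight, and the paths obtained from
   A to X + x and from X + y to B are glued along X and the arc xy. *)
Section MengerGlue.
Variables (V : finType) (D : rel V) (D_irr : irreflexive D).
Variables (A B : {set V}) (n : nat) (x y : V) (Dxy : D x y).
Variables (X : {set V}) (cX : #|X| < n).
Let D' := del_arc D x y.
Hypothesis sepX : forall a p, a \in A -> path D' a p -> last a p \in B ->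
  exists2 v, v \in a :: p & v \in X.

(** Cut a walk from [A] to [B] at its first vertex in [x |: X]: up to there it cannot use the arc
    [xy]. A walk missing [x |: X] would survive in [D'] and avoid [X], against [sepX]. *)
Lemma unseparated_src : unseparated D A B n -> unseparated D' A (x |: X) n.
Proof.
move=> uD Y /uD[a [p [aA Dp pB nY]]].
case h: (has (mem (x |: X)) (a :: p)).
  have [p1 [p2 [ep Tl nT]]] := split_first h; exists a, p1; split=> //.
    apply: path_del_arc_src; first by move: Dp; rewrite ep cat_path => /andP[].
    by apply: contra nT => xb; apply/hasP; exists x; rewrite //= setU11.
  by move=> v vp; apply: nY; rewrite ep -cat_cons mem_cat vp.
have [|v vp vX] := @sepX a p aA _ pB.
  apply: path_del_arc_src => //; apply: contraFN h => xb; apply/hasP; exists x.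
    exact: mem_belast xb.
  by rewrite /= setU11.
by case/hasP: (negbT h); exists v; rewrite //= inE vX orbT.
Qed.

Lemma unseparated_tgt : unseparated D A B n -> unseparated D' (y |: X) B n.
Proof.
move=> uD Y /uD[a [p [aA Dp pB nY]]].
case h: (has (mem (y |: X)) (a :: p)).
  have [p1 [p2 [ep Tl nT]]] := split_last h; exists (last a p1), p2; split=> //.
  - apply: path_del_arc_tgt; first by move: Dp; rewrite ep cat_path => /andP[].
    by apply: contra nT => xb; apply/hasP; exists y; rewrite //= setU11.
  - by rewrite -last_cat -ep.
  move=> v vp; apply: nY; rewrite ep.
  rewrite -cat_cons mem_cat; move: vp; rewrite inE.
  by case/orP=> [/eqP->|->]; rewrite ?mem_last ?orbT.
have [|v vp vX] := @sepX a p aA _ pB.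
  apply: path_del_arc_tgt => //; apply: contraFN h => xb; apply/hasP; exists y.
    by rewrite inE xb orbT.
  by rewrite /= setU11.
by case/hasP: (negbT h); exists v; rewrite //= inE vX orbT.
Qed.

Lemma glue_disjoint_paths (A1 A2 : {set V}) (P Q : V -> seq V) :
  A1 \subset A -> #|A1| = n -> disjoint_paths D' A1 (x |: X) P ->
  A2 \subset y |: X -> #|A2| = n -> disjoint_paths D' A2 B Q ->
  exists R, disjoint_paths D A1 B R.
Proof.
move=> sA1 c1 dP sA2 c2 dQ.
(* Sizes force equality: [x |: X] and [y |: X] have exactly [n] vertices, so every vertex of the
   first ends some [P a], and every vertex of the second starts some [Q s]. *)
have cU z : #|z |: X| <= n by rewrite cardsU1; case: (z \in X) => /=; lia.
have eA2 : A2 = y |: X by apply/eqP; rewrite eqEcard sA2 c2 cU.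
have nyX : y \notin X.
  by apply/negP=> yX; move: c2; rewrite eA2 cardsU1 yX /=; lia.
have imP := disjoint_paths_last_img dP (etrans (congr1 (leq _) c1) (cU x)).
have injP := disjoint_paths_last_inj dP.
have nxX : x \notin X.
  apply/negP=> xX; move: c1; rewrite -(card_in_imset injP) imP cardsU1 xX /=.
  by lia.
have nyx : y != x by apply: contraTneq Dxy => ->; rewrite D_irr.
case: dP dQ => [P1 P2] [Q1 Q2].
have XA2 v : v \in X -> v \in A2 by rewrite eA2 inE orbC => ->.
(* Following [P a] up to [v] and then [Q s] gives a walk in [D'] from [A] to [B], which meets [X];
   since the paths of each family are disjoint and simple, it can do so only at [v], the end of
   [P a] and the start of [Q s]. *)
have key a s v : a \in A1 -> s \in A2 -> v \in a :: P a -> v \in s :: Q s ->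
    [/\ v \in X, v = last a (P a) & v = s].
  move=> aA sA; have [pa la ua] := P1 a aA; have [ps ls us] := Q1 s sA.
  move=> /split_at[p1 [p2 [eP l1]]] /split_at[q1 [q2 [eQ l2]]].
  rewrite eP cat_path last_cat l1 in pa la ua *.
  rewrite eQ cat_path last_cat l2 in ps ls us.
  case/andP: pa => pa1 pa2; case/andP: ps => ps1 ps2.
  have [|||c] := @sepX a (p1 ++ q2); first exact: (subsetP sA1).
  - by rewrite cat_path pa1 l1.
  - by rewrite last_cat l1.
  rewrite -cat_cons mem_cat => /orP[cp|cq] cX'; last first.
    have ecs : c = s.
      apply: (Q2 c s c) => //; first exact: XA2.
        exact: mem_head.
      by rewrite eQ -cat_cons mem_cat cq orbT.
    by move: us; rewrite -cat_cons cat_uniq => /and3P[_ /hasPn/(_ c cq)];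
      rewrite /= ecs mem_head.
  have /imsetP[b bA ecb] : c \in [set last a (P a) | a in A1].
    by rewrite imP inE cX' orbT.
  have ecl : c = last v p2.
    suff eab : a = b by rewrite ecb -eab eP last_cat l1.
    apply: (P2 a b c) => //; last by rewrite ecb mem_last.
    by rewrite eP -cat_cons mem_cat cp.
  have ep2 : p2 = [::].
    case: p2 ecl ua {eP la pa2} => // d p2 ecl.
    rewrite -cat_cons cat_uniq => /and3P[_ /hasPn/(_ c)].
    by rewrite {1}ecl /= (mem_last d p2) cp => /(_ isT).
  rewrite ep2 /= in ecl *; rewrite -ecl; split=> //.
  apply: (Q2 c s c) => //; [exact: XA2|exact: mem_head|].
  by rewrite ecl eQ -cat_cons mem_cat -{1}l2 mem_last.
(* [sg a] is where the second half of the path from [a] starts: at the end of [P a], or at [y],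
   across the arc [xy], when that end is [x]. *)
pose e a := last a (P a); pose sg a := if e a == x then y else e a.
pose R a := P a ++ (if e a == x then y :: Q y else Q (e a)).
have eX a : a \in A1 -> e a != x -> e a \in X.
  by move=> /P1[_ + _]; rewrite !inE => /orP[->|].
have sgA a : a \in A1 -> sg a \in A2.
  move=> aA; rewrite /sg; case: eqP => [_|/eqP ne]; first by rewrite eA2 setU11.
  by apply/XA2/eX.
have sD u p : path D' u p -> path D u p by apply: sub_path => ? ? /andP[].
have memR a v : v \in a :: R a -> v \in a :: P a \/ v \in sg a :: Q (sg a).
  rewrite /R /sg -cat_cons mem_cat => /orP[|]; first by left.
  by case: eqP => _ h; right=> //; rewrite inE h orbT.
have yA2 : y \in A2 by rewrite eA2 setU11.
exists R; split=> [a aA|a b v aA bA].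
  have [pa la ua] := P1 a aA; rewrite /R; split.
  - rewrite cat_path sD //=; case: eqP => [ex|/eqP/(eX _ aA)/XA2 eA].
      by rewrite /= -/(e a) ex Dxy sD //; case: (Q1 y yA2).
    by rewrite sD //; case: (Q1 _ eA).
  - rewrite last_cat -/(e a); case: eqP => [ex|/eqP/(eX _ aA)/XA2 eA] /=.
      by case: (Q1 y yA2).
    by case: (Q1 _ eA).
  rewrite -cat_cons cat_uniq ua /=; case: eqP => [ex|/eqP/(eX _ aA)/XA2 eA].
    have [_ _ uy] := Q1 y yA2; rewrite uy andbT; apply/hasPn=> v vQ.
    apply/negP=> vP; have [vX _ evy] := key a y v aA yA2 vP vQ.
    by rewrite -evy vX in nyX.
  have [_ _ /=/andP[ne ->]] := Q1 _ eA; rewrite andbT; apply/hasPn=> v vQ.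
  apply/negP=> vP; have [|_ _ eve] := key a _ v aA eA vP; first by rewrite inE vQ orbT.
  by rewrite eve (negPf ne) in vQ.
have PQ c d : c \in A1 -> d \in A1 -> v \in c :: P c -> v \in sg d :: Q (sg d) ->
    c = d.
  move=> cA dA vc vd; have [vX ev es] := key _ _ _ cA (sgA _ dA) vc vd.
  apply: injP => //=; rewrite -ev; move: es; rewrite /sg.
  by case: eqP => [_ evy|_ ->] //; rewrite -evy vX in nyX.
move=> /memR[va|va] /memR[vb|vb]; [exact: (P2 a b v)|exact: PQ| |].
  by apply/esym/PQ.
have := Q2 _ _ _ (sgA _ aA) (sgA _ bA) va vb; rewrite /sg.
case: eqP => [ea|/eqP nea]; case: eqP => [eb|/eqP neb] // eab; apply: injP => //.
- by rewrite -!/(e _) ea eb.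
- by rewrite eab (eX _ bA neb) in nyX.
- by rewrite -eab (eX _ aA nea) in nyX.
Qed.
End MengerGlue.

(** Induction on the number of arcs. Pick any arc: either its deletion leaves [A] and [B]
    unseparated, or the separator that appears allows the gluing. *)
Theorem menger (V : finType) (D : rel V) (A B : {set V}) n :
  irreflexive D -> unseparated D A B n ->
  exists (A' : {set V}) (Q : V -> seq V),
    [/\ A' \subset A, #|A'| = n & disjoint_paths D A' B Q].
Proof.
have [m] := ubnP #|[set e | D e.1 e.2]|.
elim: m D A B => // m IHm D A B cD D_irr uD.
case: (classic (exists x y, D x y)) => [[x [y Dxy]]|noarc]; last first.
  (* Without arcs every walk is a single vertex, so deleting [A :&: B] separates. *)
  have le_n : n <= #|A :&: B|.
    rewrite leqNgt; apply/negP=> /uD[a [[|b p] [aA pa la nX]]].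
      by have := nX a (mem_head _ _); rewrite inE aA la.
    by case: noarc; exists a, b; case/andP: pa.
  have [A' sA cA] := subset_of_card le_n.
  exists A', (fun=> [::]); split=> //; first exact: subset_trans sA (subsetIl _ _).
  split=> [a /(subsetP sA)|a b v _ _]; first by rewrite inE => /andP[].
  by rewrite !inE => /eqP-> /eqP.
pose D' := del_arc D x y.
have cD' : #|[set e | D' e.1 e.2]| < m.
  rewrite -ltnS; apply: leq_ltn_trans cD; apply/proper_card/properP; split.
    by apply/subsetP=> e; rewrite !inE => /andP[].
  by exists (x, y); rewrite !inE //= eqxx andbF.
have D'_irr : irreflexive D' by move=> v; rewrite /D' /= D_irr.
case: (classic (unseparated D' A B n)) => [uD'|/not_all_ex_not[X nX]].
  have [A' [Q [sA cA [Q1 Q2]]]] := IHm _ _ _ cD' D'_irr uD'.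
  exists A', Q; split=> //; split=> // a /Q1[pa la ua]; split=> //.
  by apply: sub_path pa => ? ? /andP[].
have [cX {}nX] := imply_to_and _ _ nX.
have sepX a p : a \in A -> path D' a p -> last a p \in B ->
    exists2 v, v \in a :: p & v \in X.
  move=> aA pa la; apply: NNPP => h; apply: nX; exists a, p; split=> // v vp.
  by apply/negP=> vX; apply: h; exists v.
have [A1 [P [sA1 c1 dP]]] := IHm _ _ _ cD' D'_irr (unseparated_src sepX uD).
have [A2 [Q [sA2 c2 dQ]]] := IHm _ _ _ cD' D'_irr (unseparated_tgt sepX uD).
have [R dR] := glue_disjoint_paths D_irr Dxy cX sepX sA1 c1 dP sA2 c2 dQ.
by exists A1, R.
Qed.

(** * Distance layers from [u] in [D - S], and the backward arcs they force *)

Definition layering (V : finType) (D : rel V) (S : {set V}) (u : V)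
    (d : V -> nat) :=
  [/\ forall w, w \notin S -> d w = 0 -> w = u,
      forall a b, a \notin S -> b \notin S -> D a b -> d b <= (d a).+1
    & forall b, b \notin S -> 0 < d b ->
        exists a, [/\ a \notin S, D a b & d b = (d a).+1]].

Section Layers.
Variables (V : finType) (D : rel V) (S : {set V}) (u : V) (d : V -> nat).
Hypothesis d_layer : layering D S u d.

Let d0 w : w \notin S -> d w = 0 -> w = u.
Proof. by case: d_layer => + _ _; apply. Qed.
Let dS a b : a \notin S -> b \notin S -> D a b -> d b <= (d a).+1.
Proof. by case: d_layer => _ + _; apply. Qed.
Let dP b : b \notin S -> 0 < d b ->
  exists a, [/\ a \notin S, D a b & d b = (d a).+1].
Proof. by case: d_layer => _ _; apply. Qed.

(** An arc climbs at most one layer, so a path cannot skip layer [t] on its way up; it is cut at its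
    first vertex there. *)
Lemma cross_first t a p :
    (forall v, v \in a :: p -> v \notin S) -> path D a p ->
    d a <= t <= d (last a p) ->
  exists p1 p2, [/\ p = p1 ++ p2, d (last a p1) = t
                  & forall v, v \in a :: p1 -> d v <= t].
Proof.
elim: p a => [|b p IHp] a nS.
  move=> _ /= da; exists [::], [::]; split=> //=; first lia.
  by move=> v; rewrite inE => /eqP->; lia.
move=> /=/andP[Dab Dp] dt.
have dab := dS (nS a (mem_head _ _)) (nS b ltac:(by rewrite !inE eqxx orbT)) Dab.
case: (eqVneq (d a) t) => [<-|da].
  by exists [::], (b :: p); split=> //= v; rewrite inE => /eqP->.
have [||p1 [p2 [-> l1 h1]]] := IHp b _ Dp; last 1 first.
- exists (b :: p1), p2; split=> // v; rewrite inE => /orP[/eqP->|/h1//]; lia.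
- by move=> v vp; apply: nS; rewrite inE vp orbT.
- by case/andP: dt => d1 d2; apply/andP; split=> //; lia.
Qed.

Lemma cross_last t a p :
    (forall v, v \in a :: p -> v \notin S) -> path D a p ->
    d a <= t <= d (last a p) ->
  exists p1 p2, [/\ p = p1 ++ p2, d (last a p1) = t
                  & forall v, v \in last a p1 :: p2 -> t <= d v].
Proof.
move=> nS Dp /andP[da dl].
have [|p1 [p2 [ep l1 h2]]] := @split_last _ [pred v | d v <= t] a p.
  by rewrite /= da.
have {}l1 : d (last a p1) = t.
  apply/eqP; rewrite eqn_leq [_ <= t]l1 /=.
  case: p2 ep h2 => [|c p2] ep h2; first by rewrite ep cats0 in dl.
  move: Dp h2; rewrite ep cat_path /= negb_or -ltnNge => /and3P[_ Dc _].
  move=> /andP[tc _]; rewrite -ltnS; apply: leq_trans tc _.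
  apply: dS Dc; apply: nS; rewrite ep -cat_cons mem_cat ?mem_last //.
  by rewrite mem_head orbT.
exists p1, p2; split=> // v; rewrite inE => /orP[/eqP->|vp]; first lia.
by have /hasPn/(_ v vp) := h2; rewrite /= -ltnNge => /ltnW.
Qed.

Definition geodesic (n : nat) (q : nat -> V) :=
  [/\ forall i, i <= n -> q i \notin S, forall i, i <= n -> d (q i) = i
    & forall i, i < n -> D (q i) (q i.+1)].

Lemma geodesic_to w : w \notin S ->
  exists q, [/\ geodesic (d w) q, q (d w) = w & q 0 = u].
Proof.
have [n] := ubnP (d w); elim: n w => // n IHn w dwn wS.
case dw: (d w) => [|m].
  have ewu := d0 wS dw; exists (fun=> w); split=> //; split=> //.
  by move=> i; rewrite leqn0 => /eqP->.
have [a [aS Daw dwa]] := dP wS ltac:(lia).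
have [q [[qS qd qD] qa q0]] := IHn a ltac:(lia) aS.
have em : m = d a by lia.
exists (fun i => if i == m.+1 then w else q i); split; rewrite ?eqxx //.
split=> i; rewrite leq_eqVlt => /orP[/eqP ei|lt_i].
- by rewrite ei eqxx.
- by rewrite (ltn_eqF lt_i); apply: qS; lia.
- by rewrite ei eqxx dw.
- by rewrite (ltn_eqF lt_i); apply: qd; lia.
- by rewrite ei eqxx; case: eqP => [|_]; [lia|case: ei => ->; rewrite em qa].
- by rewrite !ifF; [apply: qD; lia|lia|lia].
Qed.

Lemma geodesic_path n q i m : geodesic n q -> i + m <= n ->
  path D (q i) [seq q j | j <- iota i.+1 m].
Proof.
case=> _ _ qD; elim: m i => //= m IHm i le_n.
by rewrite qD ?IHm //; lia.
Qed.

Lemma last_geodesic (q : nat -> V) i m :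
  last (q i) [seq q j | j <- iota i.+1 m] = q (i + m).
Proof.
by elim: m i => [|m IHm] i /=; rewrite ?addn0 // IHm addSnnS.
Qed.

Lemma map_geodesic n q I : geodesic n q -> all (leq^~ n) I ->
  [seq d w | w <- [seq q i | i <- I]] = I.
Proof.
case=> _ qd _ /allP leI; rewrite -map_comp -[RHS]map_id.
by apply/eq_in_map => i /leI; apply: qd.
Qed.

Variables (l : nat) (hl : 1 < l).
Hypothesis D_qt : quasi_transitive D l.

(** Quasi-transitivity gives an arc in some direction, and the forward one would climb at least two
    layers. Distinctness of the vertices is read off their layers. *)
Lemma qt_back a p :
    a \notin S -> last a p \notin S -> path D a p -> size p = l ->
    uniq [seq d w | w <- a :: p] -> d (last a p) + 2 <= d a ->
  D a (last a p).
Proof.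
move=> aS bS pa sp up dab; case: (@D_qt a (last a p)) => //.
  by exists p; do !split=> //; apply: map_uniq up.
by move=> /(dS bS aS); lia.
Qed.

Lemma geodesic_back0 n q j : geodesic n q -> l <= j <= n ->
  D (q j) (q (j - l)).
Proof.
move=> gq /andP[lj jn]; have [qS qd _] := gq.
have [|D_b|//] := @D_qt (q (j - l)) (q j).
  exists [seq q i | i <- iota (j - l).+1 l]; rewrite size_map size_iota.
  split=> //; split; first by apply: (geodesic_path gq); lia.
    by rewrite last_geodesic; congr q; lia.
  apply: (@map_uniq _ _ d); rewrite -map_cons (map_geodesic gq).
    exact: (iota_uniq _ l.+1).
  by apply/allP=> i; rewrite -[_ :: _]/(iota _ l.+1) mem_iota; lia.
have := dS (qS (j - l) ltac:(lia)) (qS j jn) D_b; rewrite !qd //; lia.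
Qed.

(** Induction on [t]. With [s = l + 2t], jump back by [s], climb [l - 2] arcs and jump back by [l]:
    a path of length [l] that descends [s + 2] layers in total. *)
Lemma geodesic_back n q t j : geodesic n q -> l + t.*2 <= j <= n ->
  D (q j) (q (j - (l + t.*2))).
Proof.
move=> gq; have [qS qd _] := gq; elim: t => [|t IHt] in j *.
  by rewrite addn0; apply: geodesic_back0.
move=> /andP[lj jn]; have {}IHt := IHt j ltac:(lia).
set s := l + t.*2 in IHt; have es : l + t.+1.*2 = s + 2 by rewrite /s; lia.
rewrite es in lj *; have ls : l <= s by rewrite /s; lia.
pose I := rcons (iota (j - s) l.-1) (j - (s + 2)).
have eI : I = (j - s) :: rcons (iota (j - s).+1 l.-2) (j - (s + 2)).
  by rewrite /I; have -> : l.-1 = l.-2.+1 by lia.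
have lastI : last (q j) [seq q i | i <- I] = q (j - (s + 2)).
  by rewrite map_rcons last_rcons.
rewrite -lastI; apply: qt_back; rewrite ?lastI ?qd; try (apply: qS); try lia.
- rewrite eI /= IHt /= map_rcons rcons_path last_geodesic.
  rewrite (geodesic_path gq) /=; last by lia.
  have := @geodesic_back0 _ _ (j - s + l.-2) gq.
  by rewrite (_ : _ - l = j - (s + 2)); [apply; lia|lia].
- by rewrite size_map size_rcons size_iota; lia.
rewrite -map_cons (map_geodesic gq).
  rewrite /= /I rcons_uniq mem_rcons inE !mem_iota iota_uniq andbT.
  by apply/andP; split; lia.
apply/allP=> i; rewrite inE mem_rcons inE mem_iota.
by case/or3P=> [/eqP->||]; lia.
Qed.

(* Each of the [b.+1] consecutive back jumps drops at least [l] layers, so the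
   vertices met before the root stay in layers [>= l]. *)
Lemma back_chain n q b j : geodesic n q -> j <= n -> b.+1 * l <= j ->
    odd j = odd (b.+1 * l) ->
  exists I, [/\ size I = b, path D (q j) [seq q i | i <- I],
    D (last (q j) [seq q i | i <- I]) (q 0), uniq (j :: I)
    & all (fun i => l <= i <= j) I].
Proof.
move=> gq; elim: b j => [|b IHb] j jn lj oj.
  exists [::]; split=> //=.
  have := @geodesic_back _ _ ((j - l) ./2) j gq; rewrite mul1n in oj lj.
  have -> : l + (j - l)./2.*2 = j by rewrite halfK oddB // oj addbb; lia.
  by rewrite subnn; apply; lia.
rewrite mulSn in lj oj.
have [|||I [sI pI dI uI aI]] := IHb (j - l); try lia.
  by rewrite oddB ?oj ?oddD; [case: (odd l); case: (odd _)|lia].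
have lt_j : l <= j - l by lia.
exists ((j - l) :: I); split=> //=; first by rewrite sI.
- rewrite pI andbT; have := @geodesic_back _ _ 0 j gq; rewrite addn0; apply.
  by lia.
- rewrite inE negb_or -andbA; apply/and3P; split=> //; first by lia.
  by apply/negP=> /(allP aI); lia.
- rewrite lt_j leq_subr /=; apply/allP=> i /(allP aI); lia.
Qed.

(** Descend from [v] to the root in [b + 1] backward jumps, then climb [d w] arcs to [w]: the length
    is [l]. The two pieces do not meet, as the descent stays in layers at least [l] before the root
    and the climb in layers below [l]. *)
Lemma back_low v w b : v \notin S -> w \notin S -> d w + b.+1 = l ->
    b.+1 * l <= d v -> odd (d v) = odd (b.+1 * l) -> d w + 2 <= d v ->
  D v w.
Proof.
move=> vS wS eb bv ov dwv.
have [q [gq qv q0]] := geodesic_to vS; have [r [gr rw r0]] := geodesic_to wS.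
have [I [sI pI dI uI aI]] := back_chain gq (leqnn _) bv ov.
rewrite qv in pI dI.
set p := [seq q i | i <- I] ++ [seq r i | i <- iota 0 (d w).+1].
have ep : last v p = w by rewrite last_cat /= last_geodesic.
rewrite -{1}ep; apply: qt_back; rewrite ?ep //.
- rewrite cat_path pI /= r0 -q0 dI /= q0 -r0.
  exact: (geodesic_path gr).
- by rewrite size_cat !size_map size_iota; lia.
have aI' : all (leq^~ (d v)) I by apply: sub_all aI => i /andP[].
have ai : all (leq^~ (d w)) (iota 0 (d w).+1).
  by apply/allP=> i; rewrite mem_iota; lia.
rewrite /p map_cons map_cat (map_geodesic gq) // (map_geodesic gr) //.
rewrite -cat_cons cat_uniq uI iota_uniq andbT andTb; apply/hasPn=> i.
rewrite mem_iota inE => /andP[_ hi]; apply/norP; split; first lia.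
by apply/negP=> /(allP aI); lia.
Qed.

(** One backward jump into layer [i] followed by [l - 1] arcs up to [w] has length [l]. The whole
    layer [i] must be dominated, since the vertex used there lies on a geodesic to [w], unrelated to
    [v]. *)
Lemma back_up v i0 t w : v \notin S ->
    (forall w', w' \notin S -> d w' = i0 -> d w' + 2 <= d v -> D v w') ->
    w \notin S -> d w = i0 + t * l.-1 -> d w + 2 <= d v ->
  D v w.
Proof.
move=> vS low; elim: t w => [|t IHt] w wS dw dwv.
  by apply: low => //; rewrite dw mul0n addn0.
have [r [gr rw _]] := geodesic_to wS; have [rS rd _] := gr.
rewrite mulSn in dw; set i := i0 + t * l.-1; have di : d w = i + l.-1 by lia.
set p := [seq r j | j <- iota i l].
have ei : iota i l = i :: iota i.+1 l.-1 by rewrite -{1}(prednK (ltnW hl)).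
have ep : last v p = w by rewrite /p ei /= last_geodesic -di.
rewrite -{1}ep; apply: qt_back; rewrite ?ep //.
- rewrite /p ei /= (geodesic_path gr) ?andbT; last by lia.
  by apply: IHt; rewrite ?rd ?rS //; lia.
- by rewrite size_map size_iota.
rewrite /= (map_geodesic gr); last by apply/allP=> j; rewrite mem_iota; lia.
by rewrite iota_uniq andbT mem_iota; lia.
Qed.

(** Layer 0 holds only the root, which one jump from [v] reaches because [d v - l] is even;
    [back_up] does the rest. *)
Lemma back_same v w t : v \notin S -> w \notin S -> odd (d v) = odd l ->
  l <= d v -> d w = t * l.-1 -> d w + 2 <= d v -> D v w.
Proof.
move=> vS wS ov lv; rewrite -[t * _]add0n; apply: back_up => // w' w'S dw' _.
have [q [gq qv q0]] := geodesic_to vS.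
have [||I [/size0nil-> _ /=]] := @back_chain _ _ 0 _ gq (leqnn _); rewrite ?mul1n //.
by rewrite qv q0 (d0 w'S dw').
Qed.

(* Back to the first vertex of a geodesic and forward to layer [l] is a path of
   length [l]; the vertex in layer [l] then jumps to the root. *)
Lemma back_diff v w t : v \notin S -> w \notin S -> odd (d v) != odd l ->
  l + 2 <= d v -> d w = l - 2 + t * l.-1 -> d w + 2 <= d v -> D v w.
Proof.
move=> vS wS ov lv; apply: back_up => // {}w {}wS dw dwv.
have [q [gq qv q0]] := geodesic_to vS; have [qS qd _] := gq.
have [r [gr rw r0]] := geodesic_to wS.
have D1 : D v (q 1).
  have := @geodesic_back _ _ ((d v - 1 - l)./2) (d v) gq.
  have -> : l + (d v - 1 - l)./2.*2 = d v - 1.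
    by rewrite halfK !oddB; lia.
  by rewrite qv (_ : d v - (d v - 1) = 1); [apply; lia|lia].
have Dl : D v (q l).
  have ep : last v [seq q i | i <- iota 1 l] = q l.
    have -> : iota 1 l = 1 :: iota 2 l.-1 by rewrite -{1}(prednK (ltnW hl)).
    by rewrite /= last_geodesic; congr q; lia.
  rewrite -ep; apply: qt_back; rewrite ?ep ?qd ?qS ?size_map ?size_iota //; try lia.
    have -> : iota 1 l = 1 :: iota 2 l.-1 by rewrite -{1}(prednK (ltnW hl)).
    by rewrite /= D1 (geodesic_path gq) //; lia.
  rewrite /= (map_geodesic gq); last by apply/allP=> j; rewrite mem_iota; lia.
  by rewrite iota_uniq andbT mem_iota; lia.
have Dl0 : D (q l) u.
  have := @geodesic_back _ _ 0 l gq; rewrite addn0 subnn q0; apply; lia.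
(* Two arcs, through [q l] to the root, and then [l - 2] arcs up to [w] make a path of length
   [l]. *)
set p := q l :: [seq r i | i <- iota 0 (d w).+1].
have ep : last v p = w by rewrite /= last_geodesic.
rewrite -{1}ep; apply: qt_back; rewrite ?ep //.
- by rewrite /= Dl r0 Dl0 -r0 (geodesic_path gr).
- by rewrite /= size_map size_iota; lia.
have ai : all (leq^~ (d w)) (iota 0 (d w).+1).
  by apply/allP=> i; rewrite mem_iota; lia.
rewrite /p map_cons map_cons (map_geodesic gr) // qd; last lia.
rewrite cons_uniq cons_uniq iota_uniq andbT inE !mem_iota.
by apply/andP; split; lia.
Qed.

(** With [f] the residue of [d w] modulo [l - 1], [back_low] reaches layer [f] by [l - f] jumps and
    [back_up] lifts this to the layer of [w]. The number of jumps, hence the parity asked of [d v],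
    depends on [w] alone; at most [l] jumps explain the bound [l * l]. *)
Lemma back_parity w : w \notin S -> exists e : bool, forall v, v \notin S ->
  odd (d v) = e -> l * l <= d v -> d w + 2 <= d v -> D v w.
Proof.
move=> wS; set f := d w %% l.-1; exists (odd ((l - f) * l)) => v vS ov lv dwv.
have lt_f : f < l.-1 by rewrite ltn_mod; lia.
apply: (@back_up v f (d w %/ l.-1)) => //; last first.
  by rewrite [LHS](divn_eq (d w) l.-1) addnC.
move=> w' w'S dw' dwv'; have e : (l - f).-1.+1 = l - f by lia.
apply: (@back_low v w' (l - f).-1) => //; rewrite e //; first by lia.
by apply: leq_trans lv; rewrite leq_mul2r leq_subr orbT.
Qed.
End Layers.

(** * Breadth-first layers, greedy selection and assembly of walks *)

Lemma ex_least (P : nat -> Prop) :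
  (exists n, P n) -> exists n, P n /\ forall m, P m -> n <= m.
Proof.
case=> n; elim/ltn_ind: n => n IHn Pn.
case: (classic (exists m, m < n /\ P m)) => [[m [lt_mn Pm]]|least].
  exact: IHn lt_mn Pm.
exists n; split=> // m Pm; rewrite leqNgt; apply/negP=> lt_mn.
by apply: least; exists m.
Qed.

Lemma bfs_layering (V : finType) (D : rel V) (S : {set V}) (u : V) :
    u \notin S ->
    (forall w, w \notin S -> exists p, [/\ path D u p, last u p = w
       & forall v, v \in p -> v \notin S]) ->
  exists d, [/\ layering D S u d, d u = 0
    & forall w, w \notin S -> exists p, [/\ path D u p, last u p = w,
        size p = d w & forall v, v \in p -> v \notin S]].
Proof.
move=> uS conn.
pose R w n := exists p, [/\ path D u p, last u p = w, size p = n
       & forall v, v \in p -> v \notin S].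
have /fin_all_exists[d dR] w : exists n,
    w \notin S -> R w n /\ forall m, R w m -> n <= m.
  case wS: (w \in S); first by exists 0.
  have [|n Rn] := @ex_least (R w); last by exists n.
  by have [p [pp lp pS]] := conn w (negbT wS); exists (size p), p.
have dS a b : a \notin S -> b \notin S -> D a b -> d b <= (d a).+1.
  move=> aS bS Dab; have [[p [pp lp <- pS]] _] := dR a aS.
  apply: (dR b bS).2; exists (rcons p b); rewrite rcons_path last_rcons lp.
  rewrite pp Dab size_rcons; split=> // v; rewrite mem_rcons inE.
  by case/orP=> [/eqP->|/pS].
exists d; split; last by move=> w /dR[].
2: by apply/eqP; rewrite -leqn0; apply: (dR u uS).2; exists [::].
split=> // [w wS dw|b bS].
  by have [p [_ lp]] := (dR w wS).1; rewrite dw -lp => /size0nil->.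
have [[p [pp lp sp pS]] _] := dR b bS.
case/lastP: p pp lp sp pS => [|p c]; first by move=> _ _ <-.
rewrite rcons_path last_rcons size_rcons => /andP[pp Dlc] ec sp pS _.
rewrite {}ec {c} in Dlc pS.
have pS' v : v \in p -> v \notin S.
  by move=> vp; apply: pS; rewrite mem_rcons inE vp orbT.
have lS : last u p \notin S.
  by have := mem_last u p; rewrite inE => /orP[/eqP->|/pS'].
exists (last u p); split=> //; apply/eqP; rewrite eqn_leq dS //= -sp ltnS.
by apply: (dR _ lS).2; exists p.
Qed.

(** Indices are treated one at a time, [F] collecting the vertices used so far, at most [c] for each
    index. *)
Lemma greedy_choice (V : finType) (k c : nat) (P : 'I_k -> seq V -> Prop) :
    (forall i (F : {set V}), #|F| <= k * c ->
       exists s, [/\ P i s, size s <= c & forall w, w \in s -> w \notin F]) ->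
  exists (g : 'I_k -> seq V) (F : {set V}),
    [/\ forall i, P i (g i), forall i j w, w \in g i -> w \in g j -> i = j,
        #|F| <= k * c & forall i w, w \in g i -> w \in F].
Proof.
move=> ext; pose good n (g : 'I_k -> seq V) (F : {set V}) :=
  [/\ forall i : 'I_k, i < n -> P i (g i),
      forall (i j : 'I_k) w, i < n -> j < n -> w \in g i -> w \in g j -> i = j,
      #|F| <= n * c & forall (i : 'I_k) w, i < n -> w \in g i -> w \in F].
suff: forall n, n <= k -> exists g F, good n g F.
  case/(_ k (leqnn k))=> g [F [gP gd cF gF]]; exists g, F; split=> //.
  - by move=> i; apply: gP.
  - by move=> i j w; apply: gd.
  by move=> i w; apply: gF.
elim=> [_|n IHn lt_nk]; first by exists (fun=> [::]), set0; split; rewrite ?cards0.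
have [g [F [gP gd cF gF]]] := IHn (ltnW lt_nk); pose i0 := Ordinal lt_nk.
have [|s [sP sc sF]] := ext i0 F.
  by apply: leq_trans cF _; rewrite leq_mul2r (ltnW lt_nk) orbT.
exists (fun i => if i == i0 then s else g i), (F :|: [set w in s]).
have lt_n (i : 'I_k) : i != i0 -> i < n.+1 -> i < n.
  by rewrite -val_eqE /= ltnS ltn_neqAle => ->.
split.
- by move=> i lt_i; case: eqP => [->//|/eqP ne]; apply/gP/lt_n.
- move=> i j w lt_i lt_j; case: eqP => [->|/eqP ni]; case: eqP => [->|/eqP nj] //.
  + by move=> /sF/negP h /(gF _ _ (lt_n _ nj lt_j)).
  + by move=> /(gF _ _ (lt_n _ ni lt_i)) h /sF/negP.
  + by apply: gd; apply: lt_n.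
- rewrite mulSn addnC; apply: leq_trans (leq_card_setU _ _) _.
  apply: leq_add => //; apply: leq_trans sc.
  by rewrite cardsE; apply: card_size.
move=> i w lt_i; rewrite !inE; case: eqP => [_ ->|/eqP ni]; first by rewrite orbT.
by move/(gF _ _ (lt_n _ ni lt_i))=> ->.
Qed.

Lemma injection_into (V : finType) (C : {set V}) (k : nat) :
  k <= #|C| -> exists2 f : 'I_k -> V, injective f & forall i, f i \in C.
Proof.
move=> le_k; exists (fun i => enum_val (widen_ord le_k i)).
  by move=> i j /enum_val_inj/(congr1 val) eq_ij; apply: val_inj.
by move=> i; apply: enum_valP.
Qed.

(** Walks confined to pairwise disjoint territories [U i] shorten to disjoint paths, so
    constructions need not exclude repeated vertices. *)
Lemma linking_of_walks (V : finType) (D : rel V) (k : nat) (x y : 'I_k -> V)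
    (U : 'I_k -> V -> Prop) :
    (forall i, exists p, [/\ path D (x i) p, last (x i) p = y i
       & forall v, v \in x i :: p -> U i v]) ->
    (forall i j v, U i v -> U j v -> i = j) ->
  exists P : 'I_k -> seq V,
    (forall i, dipath D (x i) (y i) (P i)) /\
    (forall i j, i != j -> [disjoint x i :: P i & x j :: P j]).
Proof.
move=> walk dU.
have /fin_all_exists[P hP] i : exists p, dipath D (x i) (y i) p /\
    forall v, v \in x i :: p -> U i v.
  have [p [pp <- pU]] := walk i; case: (shortenP pp) => p' pp' up' sp'.
  exists p'; split=> // v; rewrite inE => /orP[/eqP->|/sp' vp].
    by apply: pU; rewrite mem_head.
  by apply: pU; rewrite inE vp orbT.
exists P; split=> [i|i j ne_ij]; first by case: (hP i).
rewrite disjoint_subset; apply/subsetP=> v vi; rewrite inE; apply/negP=> vj.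
case/eqP: ne_ij; apply: (dU i j v); [exact: (hP i).2|exact: (hP j).2].
Qed.

(** * Consequences of strong connectivity *)

Section Strong.
Variables (V : finType) (D : rel V) (m : nat).
Hypotheses (D_irr : irreflexive D) (D_strong : strong D m).

Lemma strong_path (F : {set V}) a b : #|F| < m -> a \notin F -> b \notin F ->
  exists p, [/\ path D a p, last a p = b & forall v, v \in a :: p -> v \notin F].
Proof.
rewrite -!in_setC => cF aF bF.
have [p [[pp lp _] pF]] := D_strong.2 F cF a b aF bF.
by exists p; split=> // v /pF; rewrite inE.
Qed.

Lemma strong_avoid (F : {set V}) (x : V) : #|F| < m ->
  exists2 b, b \notin F & b != x.
Proof.
move=> cF; have lt_V : #|x |: F| < #|V|.
  by rewrite cardsU1; have := D_strong.1; case: (x \in F) => /=; lia.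
have /subsetPn[b _ ] : ~~ ([set: V] \subset x |: F).
  by apply: contraL lt_V => /subset_leq_card; rewrite cardsT -leqNgt.
by rewrite !inE negb_or => /andP[bx bF]; exists b.
Qed.

(** [x] may lie in [F], so only [F :\ x] is deleted; a path from [x] to a vertex off [F] then starts
    with the required arc. *)
Lemma strong_out (F : {set V}) (x : V) : #|F| < m ->
  exists2 z, z \notin F & D x z.
Proof.
move=> cF; have [b bF bx] := strong_avoid x cF.
have cF' : #|F :\ x| < m by apply: leq_ltn_trans (subset_leq_card (subD1set _ _)) cF.
have [||p [pp lp pF]] := @strong_path (F :\ x) x b cF'.
- by rewrite !inE eqxx.
- by rewrite !inE (negPf bF) andbF.
case: p pp lp pF => [_ /= exb|z p /=/andP[Dxz _] _ pF]; first by rewrite exb eqxx in bx.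
exists z => //; have := pF z; rewrite !inE eqxx orbT => /(_ isT).
by case: (eqVneq z x) Dxz => [->|//]; rewrite D_irr.
Qed.

Lemma strong_in (F : {set V}) (y : V) : #|F| < m ->
  exists2 z, z \notin F & D z y.
Proof.
move=> cF; have [b bF bx] := strong_avoid y cF.
have cF' : #|F :\ y| < m by apply: leq_ltn_trans (subset_leq_card (subD1set _ _)) cF.
have [||p [pp lp pF]] := @strong_path (F :\ y) b y cF'.
- by rewrite !inE (negPf bF) andbF.
- by rewrite !inE eqxx.
case/lastP: p pp lp pF => [_ /= exb|p c]; first by rewrite exb eqxx in bx.
rewrite rcons_path last_rcons => /andP[_ Dz] ec pF; rewrite ec in Dz.
exists (last b p) => //; have := pF (last b p).
rewrite -rcons_cons mem_rcons inE mem_last orbT !inE => /(_ isT).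
by case: (eqVneq (last b p) y) Dz => [->|//]; rewrite D_irr.
Qed.

End Strong.

(** * Linking when all distances are short *)

Definition terminals (V : finType) (k : nat) (x y : 'I_k -> V) : {set V} :=
  [set x i | i : 'I_k] :|: [set y i | i : 'I_k].

Lemma card_terminals (V : finType) (k : nat) (x y : 'I_k -> V) :
  #|terminals x y| <= 2 * k.
Proof.
apply: leq_trans (leq_card_setU _ _) _; rewrite mul2n -addnn.
by apply: leq_add; apply: leq_trans (leq_imset_card _ _) _; rewrite card_ord.
Qed.

Lemma terminal_src (V : finType) (k : nat) (x y : 'I_k -> V) i :
  x i \in terminals x y.
Proof. by rewrite inE imset_f. Qed.

Lemma terminal_tgt (V : finType) (k : nat) (x y : 'I_k -> V) i :
  y i \in terminals x y.
Proof. by rewrite inE orbC imset_f. Qed.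

Lemma linking_short (V : finType) (D : rel V) (k N : nat) (x y : 'I_k -> V) :
    (forall (S : {set V}) u v, #|S| <= k * (N + 2) -> u \notin S -> v \notin S ->
       exists p, [/\ dipath D u v p, size p <= N
                   & forall w, w \in p -> w \notin S]) ->
    injective x -> injective y -> (forall i j, x i <> y j) ->
  exists P : 'I_k -> seq V,
    (forall i, dipath D (x i) (y i) (P i)) /\
    (forall i j, i != j -> [disjoint x i :: P i & x j :: P j]).
Proof.
move=> short xI yI xy; pose T := terminals x y.
have xT i : x i \in T := terminal_src x y i.
have yT i : y i \in T := terminal_tgt x y i.
pose P i s := path D (x i) (rcons s (y i)) /\ forall w, w \in s -> w \notin T.
have [i F cF|g [F [gP gd _ _]]] := @greedy_choice V k N P.
  (* Used inner vertices, at most [k * N], and the terminals of the other pairs, at most [2 * k],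
     are avoided; this is where [k * (N + 2)] comes from. *)
  have [|||p [[pp lp up] sp pF]] := short ((F :|: T) :\ x i :\ y i) (x i) (y i).
  - have : #|(F :|: T) :\ x i :\ y i| <= #|F| + #|T|.
      apply: leq_trans (leq_card_setU _ _); apply: subset_leq_card.
      exact: subset_trans (subD1set _ _) (subD1set _ _).
    by have := card_terminals x y; rewrite -/T; lia.
  - by rewrite !inE eqxx andbF.
  - by rewrite !inE eqxx.
  case/lastP: p pp lp up sp pF => [_ /xy//|s c].
  rewrite last_rcons size_rcons => pp ec; rewrite {}ec {c} in pp *.
  rewrite /= mem_rcons inE negb_or rcons_uniq => /and3P[/andP[_ xs] ys _] lt_s sF.
  have sFT w : w \in s -> w \notin F :|: T.
    move=> ws; have := sF w; rewrite mem_rcons inE ws orbT => /(_ isT).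
    rewrite !inE; case: (eqVneq w (y i)) => [ew|_]; first by rewrite ew (negPf ys) in ws.
    by case: (eqVneq w (x i)) => [ew|_] //; rewrite ew (negPf xs) in ws.
  exists s; split; [split=> //|exact: ltnW|]; move=> w /sFT; rewrite inE negb_or.
    by case/andP.
  by case/andP.
apply: (@linking_of_walks _ _ _ _ _ (fun i v => [\/ v = x i, v = y i | v \in g i])).
  move=> i; exists (rcons (g i) (y i)); rewrite last_rcons; split=> //.
    by case: (gP i).
  move=> v; rewrite inE mem_rcons inE => /or3P[/eqP|/eqP|] h;
    by [apply: Or31|apply: Or32|apply: Or33].
have nT i v : v \in g i -> v \notin T by case: (gP i) => _; apply.
move=> i j v [->|->|vi] [].
- exact: xI.
- by move/xy.
- by move/nT; rewrite xT.
- by move/esym/xy.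
- exact: yI.
- by move/nT; rewrite yT.
- by move=> ev; move: vi; rewrite ev => /nT; rewrite xT.
- by move=> ev; move: vi; rewrite ev => /nT; rewrite yT.
exact: gd.
Qed.

(** * Linking along the layers when some distance is large *)

Section Long.
Variables (V : finType) (D : rel V) (k l m : nat) (S : {set V}).
Variables (u v0 : V) (d : V -> nat).
Hypotheses (D_irr : irreflexive D) (D_strong : strong D m).
Hypotheses (D_qt : quasi_transitive D l) (hl : 1 < l).
Hypotheses (uS : u \notin S) (vS : v0 \notin S) (du : d u = 0).
Hypothesis d_layer : layering D S u d.
Let N := l * l + 13 * l + 2.
Hypothesis dv : N < d v0.
Hypothesis budget : #|S| + 12 * k < m.

(** Only [S] and the part of [F] in layer [i] are deleted, so [u] and [v0] survive, being in layer 0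
    and above layer [N]. A path between them crosses layer [i], necessarily outside [F]. *)
Lemma layer_fresh (F : {set V}) i : S \subset F -> #|F| < m -> 0 < i <= N ->
  exists2 w, w \notin F & d w = i.
Proof.
move=> sSF cF /andP[i0 iN]; pose F' := [set w in F | (d w == i) || (w \in S)].
have sF' : F' \subset F by apply/subsetP=> w; rewrite inE => /andP[].
have sS w : w \notin F' -> w \notin S.
  by apply: contra => wS; rewrite inE (subsetP sSF) // wS orbT.
have [|||p [pp lp pF]] := @strong_path _ _ _ D_strong F' u v0.
- exact: leq_ltn_trans (subset_leq_card sF') cF.
- by rewrite !inE (negPf uS) du orbF; case: eqP => [|_]; rewrite ?andbF //; lia.
- by rewrite !inE (negPf vS) orbF; case: eqP => [|_]; rewrite ?andbF //; lia.
have [||p1 [p2 [ep dp _]]] := @cross_first _ _ _ _ _ d_layer i u p _ pp.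
- by move=> v /pF/sS.
- by rewrite lp du /=; lia.
exists (last u p1) => //.
have := pF (last u p1); rewrite ep -cat_cons mem_cat mem_last => /(_ isT).
by rewrite inE dp eqxx andbT.
Qed.

Lemma reach_low (F : {set V}) x : S \subset F -> #|F| < m ->
  exists s, [/\ s != [::], path D x s, size s <= 2,
    forall w, w \in s -> w \notin F & d (last x s) <= 2 * l].
Proof.
move=> sSF cF; have [z zF Dxz] := strong_out D_irr D_strong x cF.
have nS w : w \notin F -> w \notin S by apply/contra/subsetP.
case: (leqP (d z) (2 * l)) => dz.
  by exists [:: z]; rewrite /= Dxz; split=> // w; rewrite inE => /eqP->.
(* Both targets use [t = 1]: with [t = 0] the layers would be 0 and [l - 2], and layer 0 offers no
   fresh vertices. *)
pose i := if odd (d z) == odd l then l.-1 else l - 2 + l.-1.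
have [|w wF dw] := @layer_fresh F i sSF cF.
  by rewrite /i /N; case: ifP => _; nia.
exists [:: z; w] => /=; rewrite Dxz /=; split=> //.
- rewrite andbT; move: dw; rewrite /i; case: eqP => [oz|/eqP oz] dw.
    by apply: (back_same d_layer hl D_qt (t := 1)); rewrite ?nS //; lia.
  by apply: (back_diff d_layer hl D_qt (t := 1)); rewrite ?nS //; lia.
- by move=> v; rewrite !inE => /orP[]/eqP->.
by rewrite dw /i; case: ifP => _; lia.
Qed.

Lemma reach_high (F : {set V}) y : S \subset F -> #|F| < m ->
  exists y' s, [/\ path D y' (rcons s y), size s <= 1,
    forall w, w \in y' :: s -> w \notin F & 13 * l <= d y'].
Proof.
move=> sSF cF; have [z zF Dzy] := strong_in D_irr D_strong y cF.
have nS w : w \notin F -> w \notin S by apply/contra/subsetP.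
case: (leqP (13 * l) (d z)) => dz.
  by exists z, [::]; rewrite /= Dzy; split=> // w; rewrite inE => /eqP->.
have [e back] := back_parity d_layer hl D_qt (nS _ zF).
(* The two top layers [N - 1] and [N] supply either parity; both lie above [l * l] and [d z + 2]. *)
pose j := l * l + 13 * l + 1; pose i := if odd j == e then j else j.+1.
have [|w wF dw] := @layer_fresh F i sSF cF.
  by rewrite /i /j /N; case: ifP => _; lia.
have ji : j <= i by rewrite /i; case: ifP.
exists w, [:: z] => /=; rewrite Dzy !andbT; split=> //; last by rewrite dw; lia.
- apply: back; rewrite ?nS ?dw //; try lia.
  by rewrite /i; case: eqP => //=; case: (e); case: (odd j).
- by move=> v; rewrite !inE => /orP[]/eqP->.
Qed.

(* Climb the first path, jump back to the second one, climb it, and jump back to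
   the final stretch of the third one. *)
Lemma layer_walk a Qa r Qr b Qb :
    (forall v, v \in a :: Qa -> v \notin S) -> path D a Qa ->
    (forall v, v \in r :: Qr -> v \notin S) -> path D r Qr ->
    (forall v, v \in b :: Qb -> v \notin S) -> path D b Qb ->
    d a <= 2 * l -> d r <= 2 * l -> d b <= 2 * l ->
    13 * l <= d (last a Qa) -> 13 * l <= d (last r Qr) ->
    13 * l <= d (last b Qb) ->
  exists p, [/\ path D a p, last a p = last b Qb
    & forall v, v \in a :: p ->
      [\/ v \in a :: Qa /\ d v <= 5 * l, v \in r :: Qr
        | v \in b :: Qb /\ 12 * l.-1 <= d v]].
Proof.
move=> aS aP rS rP bS bP da dr db da' dr' db'.
have [|p1 [p1' [ep1 dp1 hp1]]] := cross_first d_layer (t := 5 * l) aS aP.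
  by rewrite (leq_trans da) 1?(leq_trans _ da') //; lia.
have [|p2 [p2' [ep2 dp2 _]]] := cross_first d_layer (t := 4 * l.-1) rS rP.
  by rewrite (leq_trans dr) 1?(leq_trans _ dr') //; lia.
set rho := last r p2 in dp2.
have rhoQ v : v \in rho :: p2' -> v \in r :: Qr.
  rewrite ep2 -cat_cons mem_cat inE => /orP[/eqP->|->]; last by rewrite orbT.
  by rewrite mem_last.
have rhoP : path D rho p2' by move: rP; rewrite ep2 cat_path => /andP[].
have [||p3 [p3' [ep3 dp3 _]]] :=
  cross_first d_layer (t := 13 * l) (a := rho) (p := p2') _ rhoP.
- by move=> v /rhoQ; apply: rS.
- by move: dr'; rewrite ep2 last_cat -/rho dp2 => ->; rewrite andbT; lia.
have [|p4 [p4' [ep4 dp4 hp4]]] := cross_last d_layer (t := 12 * l.-1) bS bP.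
  by rewrite (leq_trans db) 1?(leq_trans _ db') //; lia.
set gam := last b p4 in dp4 hp4.
have gamQ v : v \in gam :: p4' -> v \in b :: Qb.
  rewrite ep4 -cat_cons mem_cat inE => /orP[/eqP->|->]; last by rewrite orbT.
  by rewrite mem_last.
have p1Q v : v \in a :: p1 -> v \in a :: Qa.
  by rewrite ep1 -cat_cons mem_cat => ->.
have p3Q v : v \in rho :: p3 -> v \in r :: Qr.
  by move=> vp; apply: rhoQ; rewrite ep3 -cat_cons mem_cat vp.
(* The jumps start in layers [5 * l] and [13 * l], which have the parity of [l], and land in
   multiples of [l - 1], as [back_same] requires. *)
have odd_l c : odd c -> odd (c * l) = odd l by rewrite oddM => ->.
have J1 : D (last a p1) rho.
  apply: (back_same d_layer hl D_qt (t := 4)).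
  - exact/aS/p1Q/mem_last.
  - exact/rS/p3Q/mem_head.
  - by rewrite dp1 odd_l.
  - by rewrite dp1; lia.
  - exact: dp2.
  - by rewrite dp1 dp2; lia.
have J2 : D (last rho p3) gam.
  apply: (back_same d_layer hl D_qt (t := 12)).
  - exact/rS/p3Q/mem_last.
  - exact/bS/gamQ/mem_head.
  - by rewrite dp3 odd_l.
  - by rewrite dp3; lia.
  - exact: dp4.
  - by rewrite dp3 dp4; lia.
exists (p1 ++ rho :: p3 ++ gam :: p4'); split.
- rewrite cat_path /= J1 cat_path /= J2.
  move: aP; rewrite ep1 cat_path => /andP[-> _].
  move: rhoP; rewrite ep3 cat_path => /andP[-> _].
  by move: bP; rewrite ep4 cat_path => /andP[_ ->].
- by rewrite !(last_cat, last_cons) ep4 last_cat.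
move=> v; rewrite -cat_cons mem_cat => /orP[vp|].
  by apply: Or31; rewrite p1Q ?hp1.
rewrite -cat_cons mem_cat => /orP[vp|vp]; first exact/Or32/p3Q.
by apply: Or33; rewrite gamQ ?hp4.
Qed.

Lemma linking_long (x y : 'I_k -> V) :
    injective x -> injective y -> (forall i j, x i <> y j) ->
  exists P : 'I_k -> seq V,
    (forall i, dipath D (x i) (y i) (P i)) /\
    (forall i j, i != j -> [disjoint x i :: P i & x j :: P j]).
Proof.
move=> xI yI xy.
(* Blocked vertices: [S], at most [2k] terminals and [2k] vertices chosen at each side. Fewer than
   [3k] more are deleted at any time. *)
have card_lt_m a b : a <= #|S| + 6 * k -> b < 3 * k -> a + b < m by lia.
have low_high n : n <= 5 * l -> 12 * l.-1 <= n -> False by lia.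
pose T := terminals x y; have cT : #|T| <= 2 * k := card_terminals x y.
have xT i : x i \in T := terminal_src x y i.
have yT i : y i \in T := terminal_tgt x y i.
have cU (X Y : {set V}) : #|X :|: Y| <= #|X| + #|Y| := leq_card_setU X Y.
pose Px i s := [/\ s != [::], path D (x i) s,
  forall w, w \in s -> w \notin S :|: T & d (last (x i) s) <= 2 * l].
have [i F cF|gx [Fx [gxP gxd cFx gxF]]] := @greedy_choice V k 2 Px.
  have [||s [s0 sp ss sF sd]] := @reach_low (S :|: T :|: F) (x i).
  - by rewrite -setUA subsetUl.
  - by have := cU (S :|: T) F; have := cU S T; lia.
  by exists s; split=> //; [split=> //|]; move=> w /sF; rewrite inE negb_or => /andP[].
pose Py i s := exists y' t, [/\ s = y' :: t, path D y' (rcons t (y i)),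
  forall w, w \in s -> w \notin S :|: T :|: Fx & 13 * l <= d y'].
have [i F cF|gy [Fy [gyP gyd cFy gyF]]] := @greedy_choice V k 2 Py.
  have [||y' [t [tp st tF td]]] := @reach_high (S :|: T :|: Fx :|: F) (y i).
  - by rewrite -!setUA subsetUl.
  - have := cU (S :|: T :|: Fx) F; have := cU (S :|: T) Fx; have := cU S T; lia.
  exists (y' :: t); split=> //; first exists y', t; first split=> //.
    by move=> w /tF; rewrite inE negb_or => /andP[].
  by move=> w /tF; rewrite inE negb_or => /andP[].
pose x' i := last (x i) (gx i); pose y' i := head (y i) (gy i).
have x'g i : x' i \in gx i.
  have [+ _ _ _] := gxP i; rewrite /x'; case: (gx i) => // a s _.
  exact: (mem_last a s).
have y'g i : y' i \in gy i.
  by have [b [t [e _ _ _]]] := gyP i; rewrite /y' e mem_head.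
have x'I : injective x' by move=> i j e; apply: (gxd i j (x' i)); rewrite // e.
have y'I : injective y' by move=> i j e; apply: (gyd i j (y' i)); rewrite // e.
have gxST i w : w \in gx i -> (w \notin S) * (w \notin T).
  by case: (gxP i) => _ _ h _ /h; rewrite inE negb_or => /andP[-> ->].
have gyST i w : w \in gy i -> (w \notin S) * (w \notin T) * (w \notin Fx).
  case: (gyP i) => b [t [_ _ h _]] /h; rewrite !in_setU !negb_or.
  by case/andP=> /andP[-> ->] ->.
have gxy i j w : w \in gx i -> w \in gy j -> False.
  by move=> /gxF wF /gyST[_]; rewrite wF.
have dx' i : d (x' i) <= 2 * l by case: (gxP i).
have dy' i : 13 * l <= d (y' i).
  by have [b [t [e _ _ h]]] := gyP i; rewrite /y' e.
pose X' := [set x' i | i : 'I_k]; pose Y' := [set y' i | i : 'I_k].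
(* Of the chosen connectors only the ends [x' i] and [y' i] stay available to the Menger paths,
   which live in [W]. *)
pose O := S :|: T :|: (Fx :|: Fy) :\: (X' :|: Y'); pose W := ~: O.
have cO : #|O| <= #|S| + 6 * k.
  have := cU (S :|: T) ((Fx :|: Fy) :\: (X' :|: Y')); have := cU S T.
  have := subset_leq_card (subsetDl (Fx :|: Fy) (X' :|: Y')).
  by have := cU Fx Fy; rewrite -/O; lia.
have WS w : w \in W -> w \notin S by rewrite !inE !negb_or => /andP[/andP[]].
have WT w : w \in W -> w \notin T.
  by rewrite in_setC !in_setU !negb_or => /andP[/andP[_]].
have SO : S \subset O by rewrite /O -setUA subsetUl.
have x'W i : x' i \in W.
  rewrite in_setC in_setU in_setU in_setD !negb_or negb_and negbK !(gxST i) //.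
  by rewrite in_setU imset_f.
have y'W i : y' i \in W.
  rewrite in_setC in_setU in_setU in_setD !negb_or negb_and negbK !(gyST i) //.
  by rewrite in_setU [_ || (_ \in Y')]orbC imset_f.
have cX' : #|X'| = k by rewrite card_imset // card_ord.
have cY' : #|Y'| = k by rewrite card_imset // card_ord.
have [||A [sXA sAl cA]] := @subset_between_card V X' [set w in W | d w <= 2 * l] (3 * k).
- by apply/subsetP=> _ /imsetP[i _ ->]; rewrite inE x'W dx'.
- rewrite cX'; apply/andP; split; first lia.
  (* Were there fewer than [3k] low vertices in [W], deleting them along with [O] would still leave
     one in layer 1. For the high vertices, layer [N] serves likewise. *)
  rewrite leqNgt; apply/negP=> lt3.
  have [|||w] := @layer_fresh (O :|: [set w in W | d w <= 2 * l]) 1.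
  + exact: subset_trans SO (subsetUl _ _).
  + exact: leq_ltn_trans (cU _ _) (card_lt_m _ _ cO lt3).
  + by rewrite /N; lia.
  rewrite in_setU negb_or -in_setC inE => /andP[-> /=] + dw; rewrite dw; lia.
have [||B [sYB sBh cB]] := @subset_between_card V Y' [set w in W | 13 * l <= d w] (3 * k).
- by apply/subsetP=> _ /imsetP[i _ ->]; rewrite inE y'W dy'.
- rewrite cY'; apply/andP; split; first lia.
  rewrite leqNgt; apply/negP=> lt3.
  have [|||w] := @layer_fresh (O :|: [set w in W | 13 * l <= d w]) N.
  + exact: subset_trans SO (subsetUl _ _).
  + exact: leq_ltn_trans (cU _ _) (card_lt_m _ _ cO lt3).
  + by rewrite /N; lia.
  rewrite in_setU negb_or -in_setC inE => /andP[-> /=] + dw; rewrite dw /N; lia.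
have AW a : a \in A -> (a \in W) * (d a <= 2 * l).
  by move=> /(subsetP sAl); rewrite inE => /andP[-> ->].
have BW a : a \in B -> (a \in W) * (13 * l <= d a).
  by move=> /(subsetP sBh); rewrite inE => /andP[-> ->].
pose DW := [rel a b | [&& D a b, a \in W & b \in W]].
have [||A' [Q [sA' cA' dQ]]] := @menger V DW A B (3 * k).
- by move=> w /=; rewrite D_irr.
- move=> X cX.
  have [a aA aX] : exists2 a, a \in A & a \notin X.
    by apply/subsetPn; apply: contraL cX => /subset_leq_card; rewrite cA -leqNgt.
  have [b bB bX] : exists2 b, b \in B & b \notin X.
    by apply/subsetPn; apply: contraL cX => /subset_leq_card; rewrite cB -leqNgt.
  have [|||p [pp lp pF]] := @strong_path _ _ _ D_strong (O :|: X) a b.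
  + exact: leq_ltn_trans (cU O X) (card_lt_m _ _ cO cX).
  + by rewrite in_setU negb_or -in_setC AW.
  + by rewrite in_setU negb_or -in_setC BW.
  exists a, p; rewrite lp; split=> //; last first.
    by move=> v /pF; rewrite in_setU negb_or => /andP[].
  have {}pF v : v \in a :: p -> v \in W.
    by move=> /pF; rewrite in_setU negb_or -in_setC => /andP[].
  elim: p a pp pF {aA aX lp} => //= c p IHp a /andP[Dac pp] pF.
  rewrite Dac !pF ?inE ?eqxx ?orbT //=; apply: IHp => // v vp.
  by apply: pF; rewrite inE vp orbT.
(* As [A] and [B] both have [3k] vertices, a path starts at every [x' i] and one ends at every
   [y' i]. *)
have eA' : A' = A by apply/eqP; rewrite eqEcard sA' cA' cA leqnn.
rewrite {A' sA' cA'}eA' in dQ.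
have imQ := disjoint_paths_last_img dQ ltac:(by rewrite cA cB).
case: (dQ) => Q1 Q2.
have QD a : a \in A -> path D a (Q a).
  by move=> /Q1[+ _ _]; apply: sub_path => ? ? /and3P[].
have pW p a v : a \in W -> path DW a p -> v \in a :: p -> v \in W.
  elim: p a => [a aW _|c p IHp a aW /=/andP[/and3P[_ _ cW] pp]].
    by rewrite inE => /eqP->.
  by rewrite inE => /orP[/eqP->//|]; apply: IHp.
have QW a v : a \in A -> v \in a :: Q a -> v \in W.
  by move=> aA; apply: pW; [rewrite AW|case: (Q1 a aA)].
have QS a : a \in A -> forall v, v \in a :: Q a -> v \notin S.
  by move=> aA v /(QW _ _ aA)/WS.
have Qd a : a \in A -> (d a <= 2 * l) * (13 * l <= d (last a (Q a))).
  by move=> aA; rewrite (AW a aA); have [_ /BW[_ ->]] := Q1 a aA.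
have /fin_all_exists[b bP] i : exists b, b \in A /\ last b (Q b) = y' i.
  have /imsetP[b bA e] : y' i \in [set last a (Q a) | a in A].
    by rewrite imQ (subsetP sYB) // imset_f.
  by exists b.
have bI : injective b by move=> i j e; apply: y'I; rewrite -!(bP _).2 e.
have bA i : b i \in A := (bP i).1.
have x'A i : x' i \in A by rewrite (subsetP sXA) // imset_f.
(* Removing the starts [x' i] and [b i], at most [2k] in number, leaves [k] private paths. *)
have [|r rI rC] := @injection_into V (A :\: (X' :|: [set b i | i : 'I_k])) k.
  rewrite cardsD cA; have := subset_leq_card (subsetIr A (X' :|: [set b i | i : 'I_k])).
  by have := cU X' [set b i | i : 'I_k]; rewrite cX' (card_imset _ bI) card_ord; lia.
have rA i : r i \in A by have := rC i; rewrite inE => /andP[].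
have rx i j : r i <> x' j.
  move=> e; have := rC i; rewrite e !inE negb_or => /andP[/andP[+ _] _].
  by rewrite imset_f.
have rb i j : r i <> b j.
  move=> e; have := rC i; rewrite e !inE negb_or => /andP[/andP[_ +] _].
  by rewrite imset_f.
(* Territories are split by [W]: inside it pieces of Menger paths, outside it terminals and
   connectors. The two kinds thus never conflict. *)
pose UO i v := v = x i \/ v = y i \/ v \in gx i ++ gy i.
pose UW i v := [\/ v \in x' i :: Q (x' i) /\ d v <= 5 * l, v \in r i :: Q (r i)
  | v \in b i :: Q (b i) /\ 12 * l.-1 <= d v].
apply: (@linking_of_walks _ _ _ _ _
  (fun i v => if v \in W then UW i v else UO i v)); last first.
  move=> i j v; case: ifP => [_|_].
    case=> [[v1 d1]|v1|[v1 d1]] [[v2 d2]|v2|[v2 d2]].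
    - exact/x'I/(Q2 _ _ v).
    - by case: (rx j i); apply/esym/(Q2 _ _ v).
    - by case: (low_high (d v)).
    - by case: (rx i j); apply/(Q2 _ _ v).
    - exact/rI/(Q2 _ _ v).
    - by case: (rb i j); apply/(Q2 _ _ v).
    - by case: (low_high (d v)).
    - by case: (rb j i); apply/esym/(Q2 _ _ v).
    - exact/bI/(Q2 _ _ v).
  have gT i' w : w \in gx i' ++ gy i' -> w \in T -> False.
    by rewrite mem_cat => /orP[/gxST[_ /negP]|/gyST[[_ /negP]]].
  case=> [->|[->|vi]] [|[|vj]].
  - exact: xI.
  - by move/xy.
  - by case: (gT _ _ vj).
  - by move/esym/xy.
  - exact: yI.
  - by case: (gT _ _ vj).
  - by move=> ev; case: (gT _ _ vi); rewrite ev.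
  - by move=> ev; case: (gT _ _ vi); rewrite ev.
  move: vi vj; rewrite !mem_cat => /orP[]vi /orP[]vj.
  - exact: (gxd i j v).
  - by case: (gxy _ _ _ vi vj).
  - by case: (gxy _ _ _ vj vi).
  - exact: (gyd i j v).
move=> i; have [_ gxp _ _] := gxP i; have [y1 [t [egy typ _ _]]] := gyP i.
have ey1 : y1 = y' i by rewrite /y' egy.
have [p [pp lp pU]] := layer_walk (QS _ (x'A i)) (QD _ (x'A i))
  (QS _ (rA i)) (QD _ (rA i)) (QS _ (bA i)) (QD _ (bA i))
  (Qd _ (x'A i)).1 (Qd _ (rA i)).1 (Qd _ (bA i)).1
  (Qd _ (x'A i)).2 (Qd _ (rA i)).2 (Qd _ (bA i)).2.
rewrite (bP i).2 -ey1 in lp.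
exists (gx i ++ p ++ rcons t (y i)); split.
- by rewrite cat_path gxp cat_path pp lp.
- by rewrite !last_cat last_rcons.
have Up v : v \in x' i :: p -> if v \in W then UW i v else UO i v.
  move=> /pU vU; rewrite ifT //.
  by case: vU => [[vQ _]|vQ|[vQ _]]; apply: QW vQ.
have Ut v : v \in T -> UO i v -> if v \in W then UW i v else UO i v.
  by case: ifP => // /WT/negP.
have x'1 j : x' j \in gx i -> x' j = x' i.
  by move=> h; rewrite (gxd _ _ _ h (x'g j)).
have y'1 j : y' j \in gy i -> y' j = y' i.
  by move=> h; rewrite (gyd _ _ _ h (y'g j)).
have Ug v : v \in gx i ++ gy i -> if v \in W then UW i v else UO i v.
  move=> vg; case: ifP => vW; last by right; right.
  suff: v = x' i \/ v = y' i.
    by case=> ev; have := Up v; rewrite vW; apply; rewrite ev ?mem_head // -ey1 -lp mem_last.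
  have vF : v \in Fx :|: Fy.
    by move: vg; rewrite mem_cat inE => /orP[/gxF|/gyF] ->; rewrite ?orbT.
  have : v \in X' :|: Y'.
    by move: vW; rewrite in_setC in_setU negb_or in_setD vF andbT negbK => /andP[].
  rewrite inE => /orP[]/imsetP[j _ ev]; move: vg; rewrite ev mem_cat => /orP[] h.
  - by left; apply: x'1.
  - by case: (gxy j i (x' j)).
  - by case: (gxy i j (y' j)).
  - by right; apply: y'1.
move=> v; rewrite inE => /orP[/eqP->|]; first by apply: Ut => //; left.
rewrite mem_cat => /orP[vg|]; first by apply: Ug; rewrite mem_cat vg.
rewrite mem_cat => /orP[vp|]; first by apply: Up; rewrite inE vp orbT.
rewrite mem_rcons inE => /orP[/eqP->|vt]; first by apply: Ut => //; right; left.
by apply: Ug; rewrite mem_cat egy inE vt !orbT.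
Qed.

End Long.

(** * The numerical budget and the choice between the two cases *)

Theorem theorem1p8 (k l : nat) (hk : 2 <= k) (hl : 2 <= l)
  (V : finType) (D : rel V) (D_loopless : irreflexive D)
  (D_strong : strong D (81 * k ^ 2 * (l + 2) ^ 2))
  (D_qt : quasi_transitive D l) :
  linked D k.
Proof.
set m := 81 * k ^ 2 * (l + 2) ^ 2 in D_strong.
pose N := l * l + 13 * l + 2.
(* Since [N + 14 <= 81 * (l + 2) ^ 2], the factor [k >= 2] left over makes the inequality strict. *)
have budget : k * (N + 2) + 12 * k < m.
  have le1 : N + 14 <= 81 * (l + 2) ^ 2 by rewrite /N -mulnn; nia.
  have -> : k * (N + 2) + 12 * k = k * (N + 14) by lia.
  have -> : m = k * (k * (81 * (l + 2) ^ 2)) by rewrite /m -[k ^ 2]mulnn; lia.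
  by rewrite ltn_pmul2l; nia.
split=> [|x y xI yI xy]; first by have := D_strong.1; lia.
case: (classic (forall (S : {set V}) u v, #|S| <= k * (N + 2) ->
    u \notin S -> v \notin S ->
    exists p, [/\ dipath D u v p, size p <= N
                & forall w, w \in p -> w \notin S])) => [short|].
  exact: linking_short short xI yI xy.
move=> /not_all_ex_not[S] /not_all_ex_not[u] /not_all_ex_not[v] nS.
have [cS {}nS] := imply_to_and _ _ nS; have [uS {}nS] := imply_to_and _ _ nS.
have [vS long] := imply_to_and _ _ nS.
have cSm : #|S| < m by lia.
have [w wS|d [dl du dp]] := @bfs_layering V D S u uS.
  have [p [pp lp pS]] := strong_path D_strong cSm uS wS.
  by exists p; split=> // z zp; apply: pS; rewrite inE zp orbT.
(* Otherwise the breadth-first walk to [v] shortens to a path of length at most [N] avoiding [S],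
   contrary to the choice of [S], [u] and [v]. *)
have dv : N < d v.
  rewrite ltnNge; apply/negP=> le_N; apply: long.
  have [p [pp lp sp pS]] := dp v vS; rewrite -lp.
  case: (shortenP pp) => p' pp' up' sp'; exists p'; split=> // [|w /sp'/pS//].
  apply: leq_trans le_N; rewrite -sp uniq_leq_size //.
  by case/andP: up'.
apply: (linking_long D_loopless D_strong D_qt hl uS vS du dl dv) => //; lia.
Qed.
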